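(* Let $\mathbf{G}\in\mathbb{F}^{n\times k}$ be a generator matrix (in transposed form) of any MDS code over $\mathbb{F}$, for which $\|\mathbf{G}^{(j)}\|_0=n-k+1$ and $\|\mathbf{G}_{(i)}\|_0=w$ for all $(i,j)\in\{1,\dots,n\}\times\{1,\dots,k\}$. Then, by utilizing the column-by-column least squares algorithm for approximating $\mathbf{A}^{-1}$ described in the context, one can devise a linear MDS coded matrix inversion scheme through the encoding-decoding pair $(\tilde{\mathbf{G}},\tilde{\mathbf{D}}_{\mathcal{I}})$ given by $$\tilde{\mathbf{G}}=\mathbf{I}_T\otimes\mathbf{G},\qquad \tilde{\mathbf{D}}_{\mathcal{I}}=\mathbf{I}_T\otimes(\mathbf{G}_{\mathcal{I}})^{-1},$$ for any set $\mathcal{I}\subseteq\{1,\dots,n\}$ of $k$ responsive workers. That is, the encodings by all the workers correspond to $\tilde{\mathbf{G}}\cdot(\widehat{\mathbf{A}^{-1}})^\top$; for every $\mathcal{I}$ with $|\mathcal{I}|=k$ the encodings received from the workers in $\mathcal{I}$ constitute $\tilde{\mathbf{G}}_{\mathcal{I}}\cdot(\widehat{\mathbf{A}^{-1}})^\top$, where $\tilde{\mathbf{G}}_{\mathcal{I}}=\mathbf{I}_T\otimes\mathbf{G}_{\mathcal{I}}$; the matrix $\mathbf{G}_{\mathcal{I}}$ is invertible; $\tilde{\mathbf{D}}_{\mathcal{I}}\tilde{\mathbf{G}}_{\mathcal{I}}=\mathbf{I}_N$; and the decoding step $$\tilde{\mathbf{D}}_{\mathcal{I}}\cdot\big(\tilde{\mathbf{G}}_{\mathcal{I}}\cdot(\widehat{\mathbf{A}^{-1}})^\top\big)=(\widehat{\mathbf{A}^{-1}})^\top$$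 recovers the approximation $\widehat{\mathbf{A}^{-1}}$.
   Context: Notation: $\mathbf{G}_{(i)}$ and $\mathbf{G}^{(j)}$ are the $i$-th row and $j$-th column of $\mathbf{G}$; $\|\cdot\|_0$ is the number of nonzero entries; $\otimes$ is the Kronecker product; $\mathbf{I}_m$ is the $m\times m$ identity; $\mathbf{G}_{\mathcal{I}}$ is the submatrix of $\mathbf{G}$ consisting of the rows indexed by $\mathcal{I}$. Generator matrices are used in transposed form, i.e. $\mathbf{G}$ is $n\times k$ and its columns generate the code. A linear code of length $n$ and dimension $k$ is MDS if its distance is $d=n-k+1$. Approximate inverse: $\mathbf{A}\in\mathrm{GL}_N(\mathbb{R})$ is a real invertible $N\times N$ matrix, $k$ is a positive factor of $N$, and $T=N/k$. The algorithm outputs $\widehat{\mathbf{A}^{-1}}=[\hat{\mathbf{b}}_1\ \cdots\ \hat{\mathbf{b}}_N]$, where $\hat{\mathbf{b}}_i$ is the approximation, by a black-box least squares solver, of $\arg\min_{\mathbf{b}\in\mathbb{R}^N}\|\mathbf{A}\mathbf{b}-\mathbf{e}_i\|_2^2$, with $\mathbf{e}_i$ the $i$-th standard basis vector. It is partitioned as $\widehat{\mathbf{A}^{-1}}=[\hat{\mathcal{A}}_1\ \cdots\ \hat{\mathcal{A}}_k]$ with $\hat{\mathcal{A}}_j=[\hat{\mathbf{b}}_{(j-1)T+1}\ \cdots\ \hat{\mathbf{b}}_{jT}]\in\mathbb{R}^{N\times T}$. All workers use the same solver and parameters, so workers allocated the same block obtain the same approximation. Scheme: there are a master server and $n$ workers,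 of which $s=n-k$ may be stragglers (workers that do not respond). Each column of $\mathbf{G}$ corresponds to a block $\hat{\mathcal{A}}_j$, and each row to a worker. The $\iota$-th worker computes the $w$ blocks indexed by $\mathcal{J}_\iota=\{j:\mathbf{G}_{\iota j}\neq 0\}$, encodes them locally as $\mathbf{W}_\iota=\sum_{j\in\mathcal{J}_\iota}\mathbf{G}_{\iota j}\,\hat{\mathcal{A}}_j^\top\in\mathbb{C}^{T\times N}$, and sends $\mathbf{W}_\iota$ to the master. The encodings $\mathbf{W}_1,\dots,\mathbf{W}_n$, stacked vertically, are written as $\tilde{\mathbf{G}}\cdot(\widehat{\mathbf{A}^{-1}})^\top=(\mathbf{I}_T\otimes\mathbf{G})\cdot[\hat{\mathcal{A}}_1\ \cdots\ \hat{\mathcal{A}}_k]^\top$. The scheme is linear since the encodings are linear, and MDS since it tolerates $s=d-1$ stragglers, i.e. any $k=n-s$ responses suffice. Convention on fields: the data are real; when $\mathbb{F}$ is a finite field $\mathbb{F}_q$, its elements are identified with complex numbers (for $\beta$ a generator of $\mathbb{F}_q^\times$, $\beta^j$ is identified with $e^{2\pi i j/q}$, and $0$ with $1$), and all operations are carried out over $\mathbb{C}$.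
   Formalization: For finite F, G identified with complex numbers is additionally assumed to generate an MDS code over C (the claim fails for F_2, G = I_2), and w blocks per worker is claimed only for F embedded in C; the stacked encodings equal the Kronecker product up to a fixed reordering of rows. *)

(* Defs.v *)
From HB Require Import structures.
From mathcomp Require Import all_boot all_order all_algebra.
From mathcomp Require Import reals trigo.
From mathcomp.real_closed Require Import complex mxtens.

Set Implicit Arguments.
Unset Strict Implicit.
Unset Printing Implicit Defensive.

Import Order.TTheory GRing.Theory Num.Theory.
Local Open Scope ring_scope.

Definition l0norm (F : fieldType) (m n : nat) (M : 'M[F]_(m, n)) : nat :=
  #|[set p : 'I_m * 'I_n | M p.1 p.2 != 0]|.

Definition min_distance (F : fieldType) (n : nat) (C : {vspace 'cV[F]_n})
    (d : nat) : Prop :=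
  (exists u v : 'cV[F]_n, [/\ u \in C, v \in C, u != v & l0norm (u - v) = d])
  /\ (forall u v : 'cV[F]_n,
        u \in C -> v \in C -> u != v -> (d <= l0norm (u - v))%N).

Definition MDS (F : fieldType) (n : nat) (C : {vspace 'cV[F]_n}) : Prop :=
  min_distance C (n - \dim C + 1)%N.

Definition column_code (F : fieldType) (n k : nat) (G : 'M[F]_(n, k)) :
    {vspace 'cV[F]_n} :=
  <<[seq col j G | j <- enum 'I_k]>>%VS.

(* The transposed convention: the k columns of G form a basis of the code. *)
Definition MDS_generator (F : fieldType) (n k : nat) (G : 'M[F]_(n, k)) : Prop :=
  \dim (column_code G) = k /\ MDS (column_code G).

(* The rows of G indexed by I, in increasing order. *)
Definition select (n k : nat) (I : {set 'I_n}) (hI : #|I| = k) (i : 'I_k) : 'I_n :=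
  enum_val (cast_ord (esym hI) i).

Definition rows_of (F : fieldType) (n k : nat) (I : {set 'I_n}) (hI : #|I| = k)
    (G : 'M[F]_(n, k)) : 'M[F]_k :=
  rowsub (select hI) G.

Definition ring_embedding (F K : fieldType) (phi : F -> K) : Prop :=
  exists f : {rmorphism F -> K}, phi =1 f.

(* The elements of the finite field with q elements are realized as the q-th
   roots of unity: beta ^ j as e^(2 pi i j / q) and 0 as 1. The exponents of the
   generator beta range over 1 .. q - 1, since exponent 0 would send
   1 = beta ^ 0 and 0 to the same complex number. This map is neither additive
   nor multiplicative. *)
Definition circle_identification (R : realType) (F : fieldType)
    (phi : F -> R[i]) : Prop :=
  exists (q : nat) (beta : F),
    [/\ q.-1.-primitive_root beta,
        forall x : F, x != 0 -> exists j : nat, x = beta ^+ j,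
        phi 0 = 1
      & forall j : nat, (1 <= j < q)%N ->
          phi (beta ^+ j) = Complex (cos (2 * pi * j%:R / q%:R))
                                    (sin (2 * pi * j%:R / q%:R))].

(* How the entries of G act on real data. A field embedding (F = R, C, Q, ...)
   needs no further condition. The circle identification does not preserve the
   MDS property (over F_2 it maps the identity matrix of size 2 to a singular
   matrix), so there the identified matrix, over the complex numbers, has to
   generate an MDS code as well. *)
Definition complex_realization (R : realType) (F : fieldType) (n k : nat)
    (G : 'M[F]_(n, k)) (phi : F -> R[i]) : Prop :=
  ring_embedding phi
  \/ (circle_identification phi /\ MDS_generator (map_mx phi G)).

(* [solve M y] is the output of the black-box solver on the problem of minimizing
   |M b - y|^2 over b; no accuracy is assumed. That it is a function expresses
   that all workers computing the same column obtain the same approximation. *)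
Definition approx_inverse (R : realType) (N : nat)
    (solve : 'M[R]_N -> 'cV[R]_N -> 'cV[R]_N) (A : 'M[R]_N) : 'M[R]_N :=
  \matrix_(r < N, i < N) solve A (delta_mx i 0) r 0.

(* Here [mxtens_index (j, t)] has value j * T + t. *)
Definition block (R : realType) (N k T : nat) (hN : (k * T)%N = N)
    (B : 'M[R]_N) (j : 'I_k) : 'M[R]_(N, T) :=
  colsub (fun t : 'I_T => cast_ord hN (mxtens_index (j, t))) B.

Definition blocks_of_worker (F : fieldType) (n k : nat) (G : 'M[F]_(n, k))
    (i : 'I_n) : {set 'I_k} :=
  [set j | G i j != 0].

Definition encoding (R : realType) (N k T n : nat) (hN : (k * T)%N = N)
    (G : 'M[R[i]]_(n, k)) (B : 'M[R]_N) (i : 'I_n) : 'M[R[i]]_(T, N) :=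
  \sum_(j in blocks_of_worker G i)
     G i j *: map_mx (real_complex R) (block hN B j)^T.

Definition vstack (V : Type) (m T N : nat) (W : 'I_m -> 'M[V]_(T, N)) :
    'M[V]_(m * T, N) :=
  \matrix_(p, c) W (mxtens_unindex p).1 (mxtens_unindex p).2 c.

(* Rows of a vertical stack of m blocks of T rows are ordered by (block, offset),
   whereas 1%:M *t G, with 1%:M of size T, acts on rows ordered by
   (offset, block). This is the permutation of rows between the two orders; its
   inverse is the instance with m and T exchanged. *)
Definition swap_rows (V : Type) (m T N : nat) (X : 'M[V]_(m * T, N)) :
    'M[V]_(T * m, N) :=
  rowsub (fun p : 'I_(T * m) =>
            mxtens_index ((mxtens_unindex p).2, (mxtens_unindex p).1)) X.

Definition Gtilde (F : fieldType) (T m k : nat) (G : 'M[F]_(m, k)) :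
    'M[F]_(T * m, T * k) :=
  (1%:M : 'M[F]_T) *t G.

Definition Dtilde (F : fieldType) (T k : nat) (GI : 'M[F]_k) : 'M[F]_(T * k) :=
  (1%:M : 'M[F]_T) *t invmx GI.

(* Main.v *)
Require Import Defs.
From HB Require Import structures.
From mathcomp Require Import all_boot all_order all_algebra.
From mathcomp Require Import reals trigo.
From mathcomp.real_closed Require Import complex mxtens.

Set Implicit Arguments.
Unset Strict Implicit.
Unset Printing Implicit Defensive.

Import Order.TTheory GRing.Theory Num.Theory.
Local Open Scope ring_scope.

(** Decoding reduces to the invertibility of every [k]-row submatrix of an MDS generator matrix
    ([MDS_rows_unitmx]): a kernel vector of the submatrix would give a nonzero codeword of weight
    below the minimum distance. The mixed-product rule for Kronecker products then makes [Dtilde] a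
    left inverse of [Gtilde] ([Dtilde_GtildeK]). It remains to see that stacked encodings are a
    product by [Gtilde]. Since the identity of size [T] keeps offsets apart, this product forms, for
    each offset, the same combinations of blocks as the workers do, up to the row reordering
    [swap_rows] ([swap_rows_vstack_sum]). *)

Lemma l0norm_cV (F : fieldType) (n : nat) (v : 'cV[F]_n) :
  l0norm v = #|[set i | v i 0 != 0]|.
Proof.
have inj : injective (fun i : 'I_n => (i, 0 : 'I_1)) by move=> i j [].
rewrite /l0norm -(card_imset _ inj); apply: eq_card => -[i z].
rewrite (ord1 z) inE /=; apply/idP/imsetP => [vi|[j]].
  by exists i; rewrite ?inE.
by rewrite inE => vj [->].
Qed.

Lemma l0norm_rV (F : fieldType) (n : nat) (v : 'rV[F]_n) :
  l0norm v = #|[set j | v 0 j != 0]|.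
Proof.
have inj : injective (fun j : 'I_n => (0 : 'I_1, j)) by move=> i j [].
rewrite /l0norm -(card_imset _ inj); apply: eq_card => -[z j].
rewrite (ord1 z) inE /=; apply/idP/imsetP => [vj|[l]].
  by exists j; rewrite ?inE.
by rewrite inE => vl [->].
Qed.

Lemma mulmx_col_sum (F : fieldType) (n k : nat) (G : 'M[F]_(n, k))
    (x : 'cV[F]_k) :
  G *m x = \sum_(j < k) x j 0 *: col j G.
Proof.
apply/colP => i; rewrite !mxE summxE; apply: eq_bigr => j _.
by rewrite !mxE mulrC.
Qed.

Lemma mulmx_column_code (F : fieldType) (n k : nat) (G : 'M[F]_(n, k))
    (x : 'cV[F]_k) :
  G *m x \in column_code G.
Proof.
rewrite mulmx_col_sum; apply: memv_suml => j _; apply/memvZ/memv_span.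
by apply: map_f; rewrite mem_enum.
Qed.

(** The [k] columns span a space of dimension [k], so they are free, and [G *m x] is their
    combination with coefficients [x]. *)
Lemma mulmx_column_code_eq0 (F : fieldType) (n k : nat) (G : 'M[F]_(n, k))
    (x : 'cV[F]_k) :
  \dim (column_code G) = k -> G *m x = 0 -> x = 0.
Proof.
move=> dimG Gx0; pose X := [tuple col j G | j < k].
have /freeP freeX : free X by rewrite /free size_tuple; apply/eqP.
apply/colP => j; rewrite mxE; apply: (freeX (x ^~ 0)).
rewrite -[RHS]Gx0 mulmx_col_sum; apply: eq_bigr => i _.
by rewrite -tnth_nth tnth_mktuple.
Qed.

Lemma select_in (n k : nat) (I : {set 'I_n}) (hI : #|I| = k) (i : 'I_n) :
  i \in I -> exists j : 'I_k, i = select hI j.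
Proof.
move=> iI; exists (cast_ord hI (enum_rank_in iI i)).
by rewrite /select cast_ordK enum_rankK_in.
Qed.

(* A kernel vector of G_I yields a nonzero codeword vanishing on I, of weight at
   most n - k, below the minimum distance. *)
Lemma MDS_rows_unitmx (F : fieldType) (n k : nat) (G : 'M[F]_(n, k))
    (I : {set 'I_n}) (hI : #|I| = k) :
  MDS_generator G -> rows_of hI G \in unitmx.
Proof.
(* [det0P] yields a left kernel vector; transposing first turns it into a right one. *)
move=> [dimG [_ minG]]; rewrite unitmxE unitfE -det_tr; apply/negP => /det0P.
move=> [y y0 yG0]; pose x := y^T.
have GIx0 : rows_of hI G *m x = 0.
  by apply: trmx_inj; rewrite trmx_mul trmxK yG0 trmx0.
have Gx0 : G *m x != 0.
  apply: contra_neq y0 => /(mulmx_column_code_eq0 dimG) x0.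
  by rewrite -[y]trmxK -/x x0 trmx0.
have := minG _ _ (mulmx_column_code G x) (mem0v _) Gx0.
rewrite subr0 dimG l0norm_cV addn1.
have /subset_leq_card : [set i | (G *m x) i 0 != 0] \subset ~: I.
  (* An entry of [G *m x] at an index in [I] is an entry of [rows_of hI G *m x], hence zero. *)
  apply/subsetP => i; rewrite !inE; apply: contraNN => /(select_in hI)[j ->].
  by move/colP/(_ j): GIx0; rewrite /rows_of mul_rowsub_mx !mxE => ->.
rewrite [#|~: I|]cardsCs setCK hI card_ord => wt_le /leq_trans/(_ wt_le).
by rewrite ltnn.
Qed.

(** By the mixed-product rule the product is a Kronecker product of two identities, whose entries
    are products of two Kronecker deltas; these merge into one because [mxtens_index] is
    injective. *)
Lemma Dtilde_GtildeK (F : fieldType) (T k : nat) (G : 'M[F]_k) :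
  G \in unitmx -> Dtilde T G *m Gtilde T G = 1%:M.
Proof.
move=> uG; rewrite tensmx_mul mul1mx mulVmx //; apply/matrixP => p q.
case: (mxtens_indexP p) => t i; case: (mxtens_indexP q) => u j.
rewrite tensmxE !mxE (can_eq (@mxtens_indexK _ _)) xpair_eqE.
by rewrite -natrM mulnb.
Qed.

Lemma swap_rowsE (V : Type) (m T N : nat) (X : 'M[V]_(m * T, N)) t i c :
  swap_rows X (mxtens_index (t, i)) c = X (mxtens_index (i, t)) c.
Proof. by rewrite mxE mxtens_indexK. Qed.

Lemma vstackE (V : Type) (m T N : nat) (W : 'I_m -> 'M[V]_(T, N)) i t c :
  vstack W (mxtens_index (i, t)) c = W i t c.
Proof. by rewrite mxE mxtens_indexK. Qed.

Lemma swap_rowsK (V : Type) (m T N : nat) :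
  cancel (@swap_rows V m T N) (@swap_rows V T m N).
Proof.
move=> X; apply/matrixP => p c; case: (mxtens_indexP p) => i t.
by rewrite !swap_rowsE.
Qed.

(** The entry of [Gtilde T G] at row [(t, i)] and column [(u, j)] is [G i j] if [t = u] and zero
    otherwise, so row [(t, i)] of the product combines the rows at offset [t] of all blocks. *)
Lemma swap_rows_vstack_sum (F : fieldType) (m k T N : nat) (G : 'M[F]_(m, k))
    (B : 'I_k -> 'M[F]_(T, N)) :
  swap_rows (vstack (fun i => \sum_(j < k) G i j *: B j))
  = Gtilde T G *m swap_rows (vstack B).
Proof.
apply/matrixP => p c; case: (mxtens_indexP p) => t i.
rewrite swap_rowsE vstackE mxE summxE (reindex (@mxtens_index T k)); last first.
  exists (@mxtens_unindex T k) => q _.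
    exact: mxtens_indexK.
  exact: mxtens_unindexK.
rewrite (eq_bigr
  (fun q : 'I_T * 'I_k => (t == q.1)%:R * G i q.2 * B q.2 q.1 c)).
  rewrite -(pair_bigA _ (fun u j => (t == u)%:R * G i j * B j u c)) /=.
  (* Only the offset [u = t] survives the Kronecker delta. *)
  rewrite (bigD1 t) //= [X in _ + X]big1 ?addr0 => [|u ut].
    by apply: eq_bigr => j _; rewrite mxE eqxx mul1r.
  by apply: big1 => j _; rewrite eq_sym (negPf ut) !mul0r.
by move=> [u j] _; rewrite tensmxE swap_rowsE vstackE mxE.
Qed.

(** The blocks that a worker skips have coefficient zero, so the sum may run over all blocks. *)
Lemma encodingE (R : realType) (N k T n : nat) (hN : (k * T)%N = N)
    (G : 'M[R[i]]_(n, k)) (B : 'M[R]_N) (i : 'I_n) :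
  encoding hN G B i
  = \sum_(j < k) G i j *: map_mx (real_complex R) (block hN B j)^T.
Proof.
rewrite /encoding big_mkcond; apply: eq_bigr => j _.
by rewrite inE; case: eqP => //= ->; rewrite scale0r.
Qed.

Lemma vstack_block (R : realType) (N k T : nat) (hN : (k * T)%N = N)
    (B : 'M[R]_N) :
  castmx (esym hN, erefl N) (map_mx (real_complex R) B^T)
  = vstack (fun j : 'I_k => map_mx (real_complex R) (block hN B j)^T).
Proof.
apply/matrixP => p c; rewrite castmxE !mxE esymK cast_ord_id.
by case: p / (mxtens_indexP p) => j t; rewrite mxtens_indexK.
Qed.

Theorem theorem4 (R : realType) (F : fieldType) (n k w N T : nat)
  (hk : (0 < k)%N) (hN : (k * T)%N = N)
  (A : 'M[R]_N) (hA : A \in unitmx)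
  (solve : 'M[R]_N -> 'cV[R]_N -> 'cV[R]_N)
  (G : 'M[F]_(n, k)) (hG : MDS_generator G)
  (hcol : forall j : 'I_k, l0norm (col j G) = (n - k + 1)%N)
  (hrow : forall i : 'I_n, l0norm (row i G) = w) :
  (forall (I : {set 'I_n}) (hI : #|I| = k),
     rows_of hI G \in unitmx
     /\ Dtilde T (rows_of hI G) *m Gtilde T (rows_of hI G) = 1%:M)
  /\
  (forall phi : F -> R[i], complex_realization G phi ->
     let Gc : 'M[R[i]]_(n, k) := map_mx phi G in
     let Ainv : 'M[R]_N := approx_inverse solve A in
     let AinvT : 'M[R[i]]_N := map_mx (real_complex R) Ainv^T in
     let X : 'M[R[i]]_(T * k, N) :=
       swap_rows (castmx (esym hN, erefl N) AinvT) in
     let W : 'I_n -> 'M[R[i]]_(T, N) := encoding hN Gc Ainv in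
     [/\ (ring_embedding phi ->
            forall i : 'I_n, #|blocks_of_worker Gc i| = w),
         castmx (esym hN, erefl N) AinvT
           = vstack (fun j : 'I_k => map_mx (real_complex R) (block hN Ainv j)^T),
         swap_rows (vstack W) = Gtilde T Gc *m X
       & forall (I : {set 'I_n}) (hI : #|I| = k),
           let GI : 'M[R[i]]_k := rows_of hI Gc in
           let received : 'M[R[i]]_(k * T, N) :=
             vstack (fun i : 'I_k => W (select hI i)) in
           [/\ GI \in unitmx,
               swap_rows received = Gtilde T GI *m X,
               Dtilde T GI *m Gtilde T GI = 1%:M,
               Dtilde T GI *m (Gtilde T GI *m X) = X
             & castmx (hN, erefl N)
                 (swap_rows (Dtilde T GI *m swap_rows received)) = AinvT]]).
Proof.
split=> [I hI|phi hphi].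
  have uG := MDS_rows_unitmx hI hG.
  by split=> //; apply: Dtilde_GtildeK.
move=> Gc Ainv AinvT X W.
(* A field embedding preserves invertibility, so the MDS property over [F] suffices; under the
   circle identification the MDS property of [Gc] itself is used. *)
have uGc (I : {set 'I_n}) (hI : #|I| = k) : rows_of hI Gc \in unitmx.
  case: hphi => [[f phif]|[_ hGc]]; last exact: MDS_rows_unitmx.
  have -> : Gc = map_mx f G by apply/matrixP => i j; rewrite !mxE phif.
  by rewrite /rows_of -map_mxsub map_unitmx; apply: MDS_rows_unitmx.
(* An arbitrary choice [g] of workers covers both uses: the identity for all workers, [select hI]
   for the responsive ones. *)
have stackE m (g : 'I_m -> 'I_n) :
    swap_rows (vstack (fun i => W (g i))) = Gtilde T (rowsub g Gc) *m X.
  rewrite /X /AinvT vstack_block -swap_rows_vstack_sum; congr swap_rows.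
  apply/matrixP => p c; case: (mxtens_indexP p) => i t.
  rewrite !vstackE /W encodingE; congr (fun_of_matrix _ t c).
  by apply: eq_bigr => j _; rewrite [rowsub _ _ _ _]mxE.
split.
(* A field morphism is injective, so the nonzero entries of a row stay the same. *)
- move=> [f phif] i; rewrite -(hrow i) l0norm_rV; apply: eq_card => j.
  by rewrite !inE !mxE phif fmorph_eq0.
- exact: vstack_block.
- rewrite (stackE _ id); congr (Gtilde _ _ *m _).
  by apply/matrixP => i j; rewrite mxE.
move=> I hI GI received.
have DGK : Dtilde T GI *m Gtilde T GI = 1%:M by apply: Dtilde_GtildeK (uGc _ _).
have DGXK : Dtilde T GI *m (Gtilde T GI *m X) = X by rewrite mulmxA DGK mul1mx.
split=> //; first exact: uGc; first exact: stackE.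
(* Decoding returns [X]; undoing the row reordering and the cast in its definition leaves
   [AinvT]. *)
by rewrite [swap_rows received]stackE DGXK swap_rowsK castmxKV.
Qed.
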